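(* Let $X$ and $Y$ be two one-sided shifts of finite type and let $h:X\to Y$ be a continuous orbit equivalence. Then $h$ maps eventually periodic points to eventually periodic points (i.e. for $x\in X$, $h(x)$ is eventually periodic exactly when $x$ is), and there is an isomorphism of topological groupoids $\phi:\mathcal{G}_X\to\mathcal{G}_Y$ such that $r(\phi(\eta))=h(r(\eta))$ and $s(\phi(\eta))=h(s(\eta))$ for all $\eta\in\mathcal{G}_X$ and such that $\phi((x,\operatorname{lp}(x),x))=(h(x),\operatorname{lp}(h(x)),h(x))$ for every eventually periodic point $x\in X$.
   Context: $\mathbb{N}$ is the set of positive integers and $\mathbb{N}_0$ the set of non-negative integers. One-sided shift space: a closed subset $X\subseteq \boldsymbol{a}^{\mathbb{N}_0}$ ($\boldsymbol{a}$ a finite discrete alphabet, product topology) with $\sigma(X)=X$, where $(\sigma(x))_j=x_{j+1}$; $\sigma_X$ is the restriction of $\sigma$ to $X$. $\mathcal{L}(X)$ is the set of finite words (including the empty word) appearing in elements of $X$. $X$ is a one-sided shift of finite type if there is $m\in\mathbb{N}$ such that whenever $v\in\mathcal{L}(X)$ has length $m$ and $uv,vw\in\mathcal{L}(X)$, then $uvw\in\mathcal{L}(X)$. A point $x\in X$ is periodic if $\sigma_X^p(x)=x$ for some $p\in\mathbb{N}$, and eventually periodic if $\sigma_X^n(x)$ is periodic for some $n\in\mathbb{N}_0$. For eventually periodic $x$, $\operatorname{lp}(x):=\min\{p\in\mathbb{N}:\exists n,m\in\mathbb{N}_0,\ p=n-m,\ \sigma_X^n(x)=\sigma_X^m(x)\}$.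 A homeomorphism $h:X\to Y$ is a continuous orbit equivalence if there exist continuous maps $k,l:X\to\mathbb{N}_0$ and $k',l':Y\to\mathbb{N}_0$ with $\sigma_Y^{k(x)}(h(\sigma_X(x)))=\sigma_Y^{l(x)}(h(x))$ for all $x\in X$ and $\sigma_X^{k'(y)}(h^{-1}(\sigma_Y(y)))=\sigma_X^{l'(y)}(h^{-1}(y))$ for all $y\in Y$. For a one-sided shift of finite type $X$, $\mathcal{G}_X:=\{(x,n,x')\in X\times\mathbb{Z}\times X:\exists i,j\in\mathbb{N}_0,\ n=i-j,\ \sigma_X^i(x)=\sigma_X^j(x')\}$ with unit space $X$ (identified with $\{(x,0,x)\}$), $r(x,n,x')=x$, $s(x,n,x')=x'$, $(x,n,x')(x',n',x'')=(x,n+n',x'')$, $(x,n,x')^{-1}=(x',-n,x)$. Its topology has as basis the sets $\{(x,i-j,x'):x\in U,\ x'\in U',\ \sigma_X^i(x)=\sigma_X^j(x')\}$ where $i,j\in\mathbb{N}_0$, $U,U'\subseteq X$ are open, $\sigma_X^i|_U$ and $\sigma_X^j|_{U'}$ are injective, and $\sigma_X^i(U)=\sigma_X^j(U')$. *)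

(* Defs.v *)
From HB Require Import structures.
From mathcomp Require Import all_boot all_order all_algebra.
From mathcomp Require Import all_classical topology.
From mathcomp Require Import zify.

Set Implicit Arguments.
Unset Strict Implicit.
Unset Printing Implicit Defensive.

Import Order.TTheory GRing.Theory Num.Theory.

Local Open Scope classical_set_scope.

Definition full_shift (a : finType) : topologicalType :=
  {ptws nat -> discrete_topology a}.

Definition shift (a : finType) (x : full_shift a) : full_shift a :=
  fun j => x j.+1.

Definition language (a : finType) (X : set (full_shift a)) : set (seq a) :=
  [set w | exists x k, X x /\ w = mkseq (fun i => x (k + i)) (size w)].

Definition finite_type (a : finType) (X : set (full_shift a)) : Prop :=
  exists2 m : nat, 0 < m & forall u v w : seq a,
    language X v -> size v = m ->
    language X (u ++ v) -> language X (v ++ w) -> language X (u ++ v ++ w).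

Record sft (a : finType) := Sft {
  sft_set :> set (full_shift a);
  sft_closed : closed sft_set;
  sft_shift : @shift a @` sft_set = sft_set;
  sft_finite_type : finite_type sft_set }.

(* Through [sft_set], an [X : sft a] coerces to the type of its points, which
   carries the subspace topology. *)

Lemma shift_mem (a : finType) (X : sft a) (x : X) :
  shift (set_val x) \in (X : set (full_shift a)).
Proof.
have /seteqP[sX _] := sft_shift X.
by apply/mem_set/sX; exists (set_val x) => //; exact: set_valP.
Qed.

Definition sigma (a : finType) (X : sft a) (x : X) : X :=
  exist _ (shift (set_val x)) (shift_mem x).

Definition periodic (a : finType) (X : sft a) (x : X) : Prop :=
  exists2 p : nat, 0 < p & iter p (@sigma a X) x = x.

Definition eventually_periodic (a : finType) (X : sft a) (x : X) : Prop :=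
  exists n : nat, periodic (iter n (@sigma a X) x).

Definition eventual_period (a : finType) (X : sft a) (x : X) : set nat :=
  [set p | 0 < p /\ exists n m : nat, (p%:Z = n%:Z - m%:Z)%R /\
             iter n (@sigma a X) x = iter m (@sigma a X) x].

(* Takes the junk value 0 when [x] is not eventually periodic. *)
Definition lp (a : finType) (X : sft a) (x : X) : nat :=
  xget 0 [set p | eventual_period x p /\
                  forall q, eventual_period x q -> p <= q].

Lemma lpP (a : finType) (X : sft a) (x : X) : eventually_periodic x ->
  eventual_period x (lp x) /\ forall q, eventual_period x q -> lp x <= q.
Proof.
move=> [n [p p0 pE]].
have ex : exists p, `[< eventual_period x p >].
  exists p; apply/asboolP; split => //; exists (p + n), n; split; last by rewrite iterD.
  by rewrite PoszD; lia.
rewrite /lp; case: xgetP => [q -> []//|].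
move=> /(_ (ex_minn ex)) []; case: ex_minnP => q /asboolP xq qmin.
by split => // r xr; apply: qmin; apply/asboolP.
Qed.

Definition homeomorphism (S T : topologicalType) (f : S -> T) (g : T -> S) :
    Prop :=
  [/\ cancel f g, cancel g f, continuous f & continuous g].

Definition continuous_orbit_equivalence (a b : finType) (X : sft a) (Y : sft b)
    (h : X -> Y) : Prop :=
  exists h' : Y -> X, homeomorphism h h' /\
  (exists k l : X -> nat, [/\ continuous k, continuous l & forall x,
     iter (k x) (@sigma b Y) (h (sigma x)) = iter (l x) (@sigma b Y) (h x)]) /\
  (exists k' l' : Y -> nat, [/\ continuous k', continuous l' & forall y,
     iter (k' y) (@sigma a X) (h' (sigma y)) =
     iter (l' y) (@sigma a X) (h' y)]).

(* A groupoid is given by its arrows, which carry a topology, over a set of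
   units; [g] and [h] are composable when [gsrc g = grng h]. *)
Record groupoid := Groupoid {
  arrow :> topologicalType;
  gunit : Type;
  grng : arrow -> gunit;
  gsrc : arrow -> gunit;
  gid : gunit -> arrow;
  ginv : arrow -> arrow;
  gmul : forall g h : arrow, gsrc g = grng h -> arrow;
  grng_id : forall x, grng (gid x) = x;
  gsrc_id : forall x, gsrc (gid x) = x;
  grng_inv : forall g, grng (ginv g) = gsrc g;
  gsrc_inv : forall g, gsrc (ginv g) = grng g;
  grng_mul : forall g h (gh : gsrc g = grng h), grng (gmul gh) = grng g;
  gsrc_mul : forall g h (gh : gsrc g = grng h), gsrc (gmul gh) = gsrc h;
  gmulA : forall g h k (gh : gsrc g = grng h) (hk : gsrc h = grng k)
    (gh_k : gsrc (gmul gh) = grng k) (g_hk : gsrc g = grng (gmul hk)),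
    gmul gh_k = gmul g_hk;
  gmul1 : forall g (e : gsrc g = grng (gid (gsrc g))), gmul e = g;
  g1mul : forall g (e : gsrc (gid (grng g)) = grng g), gmul e = g;
  gmulV : forall g (e : gsrc g = grng (ginv g)), gmul e = gid (grng g);
  gVmul : forall g (e : gsrc (ginv g) = grng g), gmul e = gid (gsrc g) }.

Definition topological_groupoid_iso (G H : groupoid) (phi : G -> H) : Prop :=
  [/\ exists psi, homeomorphism phi psi,
      forall g h, gsrc g = grng h <-> gsrc (phi g) = grng (phi h) &
      forall g h (gh : gsrc g = grng h) (pgh : gsrc (phi g) = grng (phi h)),
        phi (gmul gh) = gmul pgh].

Record sft_arrow (a : finType) (X : sft a) := SftArrow {
  arng : X;
  adeg : int;
  asrc : X;
  arrowP : exists i j : nat, (adeg = i%:Z - j%:Z)%R /\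
    iter i (@sigma a X) arng = iter j (@sigma a X) asrc }.

Definition sft_basic (a : finType) (X : sft a) (i j : nat) (U U' : set X) :
    set (sft_arrow X) :=
  [set g | [/\ (adeg g = i%:Z - j%:Z)%R, U (arng g), U' (asrc g) &
    iter i (@sigma a X) (arng g) = iter j (@sigma a X) (asrc g)]].

Definition sft_basis (a : finType) (X : sft a) : set (set (sft_arrow X)) :=
  [set B | exists (i j : nat) (U U' : set X), B = sft_basic i j U U' /\
    [/\ open U, open U', set_inj U (iter i (@sigma a X)),
        set_inj U' (iter j (@sigma a X)) &
        iter i (@sigma a X) @` U = iter j (@sigma a X) @` U']].

Section SftBasis.
Variables (a : finType) (X : sft a).
Local Notation sg := (@sigma a X).

Lemma sft_arrow_inj (g h : sft_arrow X) :
  arng g = arng h -> adeg g = adeg h -> asrc g = asrc h -> g = h.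
Proof.
case: g => x n y p; case: h => x' n' y' p' /= ex en ey.
by subst; rewrite (Prop_irrelevance p p').
Qed.

Definition cylinder (n : nat) (x : full_shift a) : set (full_shift a) :=
  [set y | forall k, k < n -> y k = x k].

Lemma cylinder_nbhs n (x : full_shift a) : nbhs x (cylinder n x).
Proof.
elim: n => [|n IHn]; first by apply: filterS filterT => y _ k.
have nn : nbhs x [set y : full_shift a | y n = x n].
  have := @proj_continuous nat (fun=> discrete_topology a) n x
    [set x n].
  by apply; rewrite /nbhs/=; exact/principal_filterP.
apply: filterS (filterI IHn nn) => y [yn yE] k.
by rewrite ltnS leq_eqVlt => /predU1P[->//|]; exact: yn.
Qed.

Lemma nbhs_cylinder (x : full_shift a) (A : set (full_shift a)) :
  nbhs x A -> exists n, cylinder n x `<=` A.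
Proof.
pose F := filter_from [set: nat] (fun n => cylinder n x).
have FF : Filter F.
  apply: filter_from_filter; first by exists 0.
  move=> i j _ _; exists (maxn i j) => // y yij; split => k kl;
    by apply: yij; lia.
suff : F --> x by move=> /[apply] -[n _ nA]; exists n.
apply/cvg_sup => i B [C [[D oD <-] Dx DB]]; exists i.+1 => // y yx.
by apply: DB => /=; rewrite yx.
Qed.

Lemma nbhs_sftP (x : X) (A : set X) : nbhs x A <->
  exists n, [set y : X | cylinder n (set_val x) (set_val y)] `<=` A.
Proof.
split=> [|[n nA]].
  move=> [B [[C oC <-] Cx CA]].
  have [n nC] : exists n, cylinder n (set_val x) `<=` C.
    by apply: nbhs_cylinder; exact: open_nbhs_nbhs.
  by exists n => y yx; apply: CA; exact: nC.
apply: filterS nA _.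
have /= := @initial_continuous X _ (set_val : X -> full_shift a) x.
by apply; exact: cylinder_nbhs.
Qed.

Lemma sigma_continuous : continuous sg.
Proof.
move=> x A /nbhs_sftP[n nA]; apply/nbhs_sftP; exists n.+1 => y yx.
by apply: nA => k kn /=; exact: (yx k.+1).
Qed.

Lemma iter_sigma_continuous i : continuous (iter i sg).
Proof.
elim: i => [|i IHi] x; first exact: cvg_id.
by apply: (@continuous_comp _ _ _ (iter i sg) sg); [exact: IHi|exact: sigma_continuous].
Qed.

Lemma iter_sigmaE i (x : X) k : set_val (iter i sg x) k = set_val x (i + k).
Proof. by elim: i k => // i IHi k; rewrite addSnnS -IHi. Qed.

Lemma language_prefix (w : seq a) : language X w ->
  exists2 x, sft_set X x & w = mkseq x (size w).
Proof.
move=> [x [k [Xx wE]]]; pose y := iter k sg (exist _ x (mem_set Xx)).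
exists (set_val y); first exact: set_valP.
by rewrite {1}wE; apply: eq_mkseq => i; rewrite iter_sigmaE.
Qed.

Lemma prefix_language (x : full_shift a) n : sft_set X x -> language X (mkseq x n).
Proof. by move=> Xx; exists x, 0; rewrite size_mkseq. Qed.

Lemma mkseqD (f : nat -> a) m n :
  mkseq f (m + n) = mkseq f m ++ mkseq (fun i => f (m + i)) n.
Proof.
rewrite /mkseq iotaD map_cat add0n; congr (_ ++ _).
by rewrite -{1}(addn0 m) iotaDl -map_comp.
Qed.

Lemma sigma_open (U : set X) : open U -> open (sg @` U).
Proof.
rewrite !openE => oU y [x Ux <-{y}].
have /nbhs_sftP[N NU] := oU _ Ux.
have [m m0 mX] := sft_finite_type X.
apply/nbhs_sftP; exists (maxn N m) => y yx.
pose z : full_shift a := fun k => if k is k'.+1 then set_val y k' else set_val x 0.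
have Xz : sft_set X z.
  suff : closure (sft_set X) z by exact: sft_closed.
  move=> B /nbhs_cylinder[n nB].
  have [] := @language_prefix (mkseq z (1 + (m + n))).
    rewrite !mkseqD; apply: mX.
    - by apply: (@prefix_language (set_val y)); exact: set_valP.
    - by rewrite size_mkseq.
    - rewrite -mkseqD; have -> : mkseq z (1 + m) = mkseq (set_val x) (1 + m).
        apply/eq_in_map => k; rewrite mem_iota add0n => /andP[_].
        case: k => // k km /=; rewrite (yx k) //; lia.
      by apply: prefix_language; exact: set_valP.
    - rewrite -(mkseqD (fun i => z (1 + i))).
      by apply: (@prefix_language (set_val y)); exact: set_valP.
  move=> t Xt tE; exists t; split => //; apply: nB => k kn.
  rewrite size_mkseq in tE.
  have := congr1 (fun s => nth (z 0) s k) tE.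
  by rewrite !nth_mkseq //; lia.
exists (exist _ z (mem_set Xz)).
  apply: NU => -[|k] kN; rewrite set_valE //=; apply: (yx k); lia.
by apply: val_inj.
Qed.

Lemma iter_sigma_open i (U : set X) : open U -> open (iter i sg @` U).
Proof.
move=> oU; elim: i => [|i IHi]; first by rewrite image_id.
rewrite (_ : _ @` _ = sg @` (iter i sg @` U)); first exact: sigma_open.
by rewrite -image_comp.
Qed.

Lemma iter_sigma_inj i (x : X) :
  set_inj [set y : X | cylinder i (set_val x) (set_val y)] (iter i sg).
Proof.
move=> y z /set_mem yx /set_mem zx e; apply: val_inj; apply: funext => k.
rewrite -[LHS]/(set_val y k) -[RHS]/(set_val z k).
have [ki|ik] := ltnP k i; first by rewrite yx// zx.
by rewrite -(subnKC ik) -!iter_sigmaE e.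
Qed.

Lemma open_cylinder i (x : X) :
  open [set y : X | cylinder i (set_val x) (set_val y)].
Proof.
rewrite openE => y yx; apply/nbhs_sftP; exists i => z zy k ki.
by rewrite zy// yx.
Qed.

Lemma sft_basic_in_basis i j (U U' : set X) : open U -> open U' ->
  set_inj U (iter i sg) -> set_inj U' (iter j sg) ->
  sft_basis (sft_basic i j U U').
Proof.
move=> oU oU' iU iU'; pose V := (iter i sg @` U) `&` (iter j sg @` U').
have oV : open V by apply: openI; exact: iter_sigma_open.
have cV k : open (iter k sg @^-1` V).
  by apply: open_comp => // x _; exact: iter_sigma_continuous.
exists i, j, (U `&` iter i sg @^-1` V), (U' `&` iter j sg @^-1` V); split.
  apply/seteqP; split=> g /= [gd gU gU' gE].
    split=> //; split => //; split.
    - by exists (arng g).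
    - by exists (asrc g).
    - by exists (arng g).
    - by exists (asrc g).
  by case: gU gU' => ? _ [].
split; do ?exact: openI.
- by move=> x y /set_mem[xU _] /set_mem[yU _]; apply: iU; exact/mem_set.
- by move=> x y /set_mem[xU _] /set_mem[yU _]; apply: iU'; exact/mem_set.
- apply/seteqP; split=> _ [x [Ux [xi xj]] <-].
    by case: (xj) => y Uy yx; exists y => //; split => //=; rewrite yx.
  by case: (xi) => y Uy yx; exists y => //; split => //=; rewrite yx.
Qed.

Lemma sft_basis_cover : \bigcup_(B in @sft_basis a X) B = setT.
Proof.
apply/seteqP; split => // g _; have [i [j [gd gE]]] := arrowP g.
exists (sft_basic i j
    [set y | cylinder i (set_val (arng g)) (set_val y)]
    [set y | cylinder j (set_val (asrc g)) (set_val y)]).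
  apply: sft_basic_in_basis;
    by [exact: open_cylinder | exact: iter_sigma_inj].
by split.
Qed.

Lemma sft_basis_join (B C : set (sft_arrow X)) (g : sft_arrow X) :
  sft_basis B -> sft_basis C -> B g -> C g ->
  exists D, [/\ sft_basis D, D g & D `<=` B `&` C].
Proof.
move=> [i1 [j1 [U1 [U1' [-> [o1 o1' n1 n1' _]]]]]].
move=> [i2 [j2 [U2 [U2' [-> [o2 o2' n2 n2' _]]]]]].
wlog le12 : i1 j1 U1 U1' i2 j2 U2 U2' o1 o1' n1 n1' o2 o2' n2 n2' / i1 <= i2.
  move=> wl; have [|/ltnW] := leqP i1 i2; first exact: wl.
  move=> le21 B1 B2.
  have [D [bD Dg DBC]] := wl _ _ _ _ _ _ _ _ o2 o2' n2 n2' o1 o1' n1 n1' le21 B2 B1.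
  by exists D; rewrite setIC.
move=> [d1 r1 s1 e1] [d2 r2 s2 e2].
exists (sft_basic i1 j1 (U1 `&` U2) (U1' `&` U2')); split => //.
- apply: sft_basic_in_basis; do ?exact: openI.
  + by move=> x y /set_mem[xU _] /set_mem[yU _]; apply: n1; exact/mem_set.
  + by move=> x y /set_mem[xU _] /set_mem[yU _]; apply: n1'; exact/mem_set.
- move=> f [df [rf1 rf2] [sf1 sf2] ef]; split; split => //.
    by rewrite df -d1.
  have -> : i2 = (i2 - i1) + i1 by lia.
  have -> : j2 = (i2 - i1) + j1 by move: d1; rewrite d2; lia.
  by rewrite !iterD ef.
Qed.

End SftBasis.

HB.instance Definition _ (a : finType) (X : sft a) :=
  gen_eqMixin (sft_arrow X).
HB.instance Definition _ (a : finType) (X : sft a) :=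
  gen_choiceMixin (sft_arrow X).
HB.instance Definition _ (a : finType) (X : sft a) :=
  isBaseTopological.Build (sft_arrow X) (D := @sft_basis a X) (b := id)
    (sft_basis_cover X) (@sft_basis_join a X).

Lemma open_sft_arrowP (a : finType) (X : sft a) (W : set (sft_arrow X)) :
  open W <-> forall g, W g -> exists B, [/\ sft_basis B, B g & B `<=` W].
Proof.
split=> [[D DB <-] g [B DB' Bg]|bW].
  by exists B; split; [exact: DB|by []|move=> h Bh; exists B].
exists [set B | sft_basis B /\ B `<=` W]; first by move=> B [].
apply/seteqP; split=> [g [B [_ BW] /BW]//|g /bW[B [bB Bg BW]]].
by exists B.
Qed.

Section SftGroupoid.
Variables (a : finType) (X : sft a).
Local Notation sg := (@sigma a X).

Lemma id_arrowP (x : X) : exists i j : nat,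
  (0 = i%:Z - j%:Z)%R /\ iter i sg x = iter j sg x.
Proof. by exists 0, 0. Qed.

Lemma inv_arrowP (g : sft_arrow X) : exists i j : nat,
  (- adeg g = i%:Z - j%:Z)%R /\ iter i sg (asrc g) = iter j sg (arng g).
Proof.
by have [i [j [-> e]]] := arrowP g; exists j, i; split; first by rewrite opprB.
Qed.

Lemma mul_arrowP (g h : sft_arrow X) : asrc g = arng h -> exists i j : nat,
  (adeg g + adeg h = i%:Z - j%:Z)%R /\
  iter i sg (arng g) = iter j sg (asrc h).
Proof.
move=> gh; have [i [j [-> e]]] := arrowP g; have [k [l [-> f]]] := arrowP h.
exists (k + i), (j + l); split; first by rewrite !PoszD; lia.
by rewrite !iterD e gh -f -!iterD addnC.
Qed.

Definition id_arrow (x : X) := SftArrow (id_arrowP x).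
Definition inv_arrow (g : sft_arrow X) := SftArrow (inv_arrowP g).
Definition mul_arrow (g h : sft_arrow X) (gh : asrc g = arng h) :=
  SftArrow (mul_arrowP gh).

Lemma lp_arrowP (x : X) : eventually_periodic x -> exists i j : nat,
  ((lp x)%:Z = i%:Z - j%:Z)%R /\ iter i sg x = iter j sg x.
Proof. by move=> /lpP[[_]]. Qed.

Definition lp_arrow (x : X) (ex : eventually_periodic x) : sft_arrow X :=
  SftArrow (lp_arrowP ex).

Lemma mul_arrowA (g h k : sft_arrow X) (gh : asrc g = arng h)
    (hk : asrc h = arng k) (gh_k : asrc (mul_arrow gh) = arng k)
    (g_hk : asrc g = arng (mul_arrow hk)) :
  mul_arrow gh_k = mul_arrow g_hk.
Proof. by apply: sft_arrow_inj => //=; rewrite addrA. Qed.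

Lemma mul_arrow1 (g : sft_arrow X) (e : asrc g = arng (id_arrow (asrc g))) :
  mul_arrow e = g.
Proof. by apply: sft_arrow_inj => //=; rewrite addr0. Qed.

Lemma mul_1arrow (g : sft_arrow X) (e : asrc (id_arrow (arng g)) = arng g) :
  mul_arrow e = g.
Proof. by apply: sft_arrow_inj => //=; rewrite add0r. Qed.

Lemma mul_arrowV (g : sft_arrow X) (e : asrc g = arng (inv_arrow g)) :
  mul_arrow e = id_arrow (arng g).
Proof. by apply: sft_arrow_inj => //=; rewrite subrr. Qed.

Lemma mul_Varrow (g : sft_arrow X) (e : asrc (inv_arrow g) = arng g) :
  mul_arrow e = id_arrow (asrc g).
Proof. by apply: sft_arrow_inj => //=; rewrite addNr. Qed.

Definition sft_groupoid : groupoid :=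
  @Groupoid (sft_arrow X) X (@arng a X) (@asrc a X) id_arrow inv_arrow mul_arrow
    (fun=> erefl) (fun=> erefl) (fun=> erefl) (fun=> erefl)
    (fun _ _ _ => erefl) (fun _ _ _ => erefl)
    mul_arrowA mul_arrow1 mul_1arrow mul_arrowV mul_Varrow.

End SftGroupoid.

(* Main.v *)
Require Import Defs.
From mathcomp Require Import all_boot all_order all_algebra.
From mathcomp Require Import all_classical topology.
From mathcomp Require Import zify.

(* Writing c = l - k and c_i for its Birkhoff sums along sigma, the formula
   (x, i - j, x') |-> (h x, c_i(x) - c_j(x'), h x') defines a continuous
   homomorphism G_X -> G_Y over h, and likewise for h^-1. Over a non-isolated
   point x the composite of the two preserves degrees, because a nonzero defect
   would make all points near x eventually periodic with the same preperiod and
   period, hence x isolated. As c_p(x) > 0 when x is moreover p-periodic (by expansivity), both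
   homomorphisms send the generator lp of the isotropy group to the generator lp.
   Isolated points of a shift of finite type are eventually periodic, and the
   isolated periodic points form a clopen set on which k and l can be changed
   freely: changing them at one point of each periodic orbit makes the homomorphism
   preserve lp there too. It is then bijective, and it is open since the range maps
   are local homeomorphisms. *)

Set Implicit Arguments.
Unset Strict Implicit.
Unset Printing Implicit Defensive.

Import GRing.Theory.

Local Open Scope classical_set_scope.

Lemma near_image (S T : topologicalType) (f : S -> T) (x : S) (P : T -> Prop) :
  continuous f -> (\forall u \near f x, P u) -> \forall y \near x, P (f y).
Proof. by move=> fc; exact: fc. Qed.

(** * Cylinders, isolated points and least periods in a single shift *)

Section OneShift.
Variables (a : finType) (X : sft a).
Local Notation sg := (@sigma a X).
Implicit Types (x y z : X) (i j m n p : nat).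

Definition agree n x y : Prop := cylinder n (set_val x) (set_val y).

Definition is_isolated x : Prop := exists n, forall y, agree n x y -> y = x.

(** Stands in for continuity into a discrete space and makes sense for any target type, such as the
    pairs of lags chosen in [adjust_orbit_lags]. *)
Definition locally_constant (T : Type) (f : X -> T) : Prop :=
  forall x, \forall y \near x, f y = f x.

Lemma agreexx n x : agree n x x.
Proof. by []. Qed.

Lemma agreeW m n x y : m <= n -> agree n x y -> agree m x y.
Proof. by move=> mn xy i im; apply: xy; exact: leq_trans mn. Qed.

Lemma agree_iter i n x y :
  agree (i + n) x y -> agree n (iter i sg x) (iter i sg y).
Proof. by move=> xy k kn; rewrite !iter_sigmaE xy// ltn_add2l. Qed.

Lemma agree_cat i n x y :
  agree i x y -> agree n (iter i sg x) (iter i sg y) -> agree (i + n) x y.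
Proof.
move=> xy xyi k kin; have [/xy//|ik] := ltnP k i.
by rewrite -(subnKC ik) -!iter_sigmaE xyi// ltn_subLR.
Qed.

Lemma agree_eq x y : (forall n, agree n x y) -> y = x.
Proof.
by move=> xy; apply: val_inj; apply: funext => k; exact: (xy k.+1 k (ltnSn k)).
Qed.

Lemma agree_inj i x y : agree i x y -> iter i sg y = iter i sg x -> y = x.
Proof.
move=> xy e; apply: agree_eq => n; apply: (@agreeW n (i + n)).
  exact: leq_addl.
by apply: agree_cat => //; rewrite e.
Qed.

Lemma nbhs_agree x (A : set X) :
  nbhs x A <-> exists n, forall y, agree n x y -> A y.
Proof. by split=> /nbhs_sftP. Qed.

Lemma near_agree n x : \forall y \near x, agree n x y.
Proof. by apply/nbhs_agree; exists n. Qed.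

Lemma continuous_locally_constant (f : X -> nat) :
  continuous f -> locally_constant f.
Proof.
move=> cf x; have : nbhs (f x) [set f x].
  by rewrite nbhs_principalE; exact/principal_filterP.
exact: cf.
Qed.

(** Here [m] is the memory: the prefix of [x] of length [s + m] overlaps [y] in a word of length
    [m], so finite type allows the two to be joined. *)
Lemma sft_glue : exists m, forall s x y, agree m (iter s sg x) y ->
  exists2 z, agree (s + m) x z & iter s sg z = y.
Proof.
have [m m0 mX] := sft_finite_type X; exists m => s x y xy.
pose z : full_shift a := fun i =>
  if i < s then set_val x i else set_val y (i - s).
have zx i : i < s + m -> z i = set_val x i.
  move=> ism; rewrite /z; case: ltnP => // si.
  by rewrite xy ?ltn_subLR// iter_sigmaE subnKC.
have zy i : z (s + i) = set_val y i by rewrite /z ltnNge leq_addr addKn.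
have Xz : sft_set X z.
  (* Only prefixes of [z] are known to be in the language; points of [X] sharing them converge to
     [z], and [X] is closed. *)
  suff : closure (sft_set X) z by exact: sft_closed.
  move=> B /nbhs_cylinder[n nB].
  have [] := @language_prefix _ X (mkseq z (s + (m + n))).
    rewrite !mkseqD; apply: mX.
    - exists (set_val x), s; split; first exact: set_valP.
      rewrite size_mkseq; apply/eq_in_map => i.
      by rewrite mem_iota add0n => /andP[_ im]; rewrite zx// ltn_add2l.
    - by rewrite size_mkseq.
    - rewrite -mkseqD; have -> : mkseq z (s + m) = mkseq (set_val x) (s + m).
        by apply/eq_in_map => i; rewrite mem_iota add0n => /andP[_]; exact: zx.
      by apply: prefix_language; exact: set_valP.
    - rewrite -(mkseqD (fun i => z (s + i))) (eq_mkseq zy).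
      by apply: prefix_language; exact: set_valP.
  move=> t Xt tE; exists t; split => //; apply: nB => i im.
  rewrite size_mkseq in tE.
  have := congr1 (fun w => nth (z 0) w i) tE.
  by rewrite !nth_mkseq //; lia.
exists (exist _ z (mem_set Xz)) => [i ism|]; first exact: zx.
apply: val_inj; apply: funext => i.
by rewrite -[LHS]/(set_val _ i) iter_sigmaE; exact: zy.
Qed.

(** Upwards, [sigma^i] is injective on cylinders of length [i]; downwards, a point close to
    [sigma^i x] is glued to the prefix of [x], and the result is close to [x]. *)
Lemma isolated_iter i x : is_isolated (iter i sg x) <-> is_isolated x.
Proof.
split=> [[n xn]|[n xn]].
  exists (i + n) => y xy; apply: (@agree_inj i).
    exact: agreeW (leq_addr _ _) xy.
  by apply: xn; exact: agree_iter.
have [m glue] := sft_glue; exists (m + n) => y xy.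
have [z xz zE] := glue i x y (agreeW (leq_addr _ _) xy).
rewrite -zE; congr iter.
apply: xn; apply: (@agreeW n (i + n)); first exact: leq_addl.
apply: agree_cat; first exact: agreeW (leq_addr _ _) xz.
by rewrite zE; exact: agreeW (leq_addl _ _) xy.
Qed.

(* Past its isolating prefix an isolated point admits no branching, so two
   occurrences of the same word of memory length force the tails to be equal. *)
Lemma isolated_eventually_periodic x : is_isolated x ->
  exists i j, i < j /\ iter i sg x = iter j sg x.
Proof.
move=> [n xn]; have [m glue] := sft_glue.
pose f (s : 'I_#|{:m.-tuple a}|.+1) :=
  [tuple set_val (iter (n + s) sg x) i | i < m].
have /injectivePn[s [t st fst]] : ~~ injectiveb f.
  by apply/negP => /injectiveP/leq_card; rewrite card_ord ltnn.
wlog lst : s t st fst / s < t.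
  move=> wl; have [lst|lts|/val_inj e] := ltngtP s t.
  - exact: wl lst.
  - by apply: wl lts; rewrite // eq_sym.
  - by rewrite e eqxx in st.
exists (n + s), (n + t); split; first by rewrite ltn_add2l.
have [|z xz zE] := glue (n + s) x (iter (n + t) sg x).
  move=> i im; have := congr1 (fun u : m.-tuple a => tnth u (Ordinal im)) fst.
  by rewrite !tnth_mktuple.
by rewrite -zE (xn z) //; apply: agreeW xz; rewrite -addnA leq_addr.
Qed.

Lemma iter_periodic t p x : iter p sg x = x -> iter (t * p) sg x = x.
Proof. by move=> xp; elim: t => // t IHt; rewrite mulSn iterD IHt. Qed.

(** Prefixing [n] periods of [x] to [y] gives a point in the isolating cylinder of [x]. That [m]
    does not depend on [x] makes the set of isolated periodic points closed. *)
Lemma isolated_periodic_cylinder : exists m, forall x p,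
  is_isolated x -> 0 < p -> iter p sg x = x -> forall y, agree m x y -> y = x.
Proof.
have [m glue] := sft_glue; exists m => x p [n xn] p0 xp y xy.
have xnp : iter (n * p) sg x = x by exact: iter_periodic.
have [|z xz <-] := glue (n * p) x y; first by rewrite xnp.
by rewrite (xn z) //; apply: agreeW xz; nia.
Qed.

Lemma eventually_periodicP x :
  eventually_periodic x <-> exists i j, i < j /\ iter i sg x = iter j sg x.
Proof.
split=> [[n [p p0 xp]]|[i [j [ij xij]]]].
  by exists n, (p + n); split; [lia|rewrite iterD].
by exists i, (j - i); [lia|rewrite -iterD subnK// ltnW].
Qed.

(** If [A < B], each coordinate [i >= B] of a point near [x] repeats the coordinate [i - (B - A)],
    so finitely many coordinates determine the point. *)
Lemma locally_preperiodic_isolated x A B :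
  ~ is_isolated x -> (\forall y \near x, iter A sg y = iter B sg y) -> A = B.
Proof.
move=> nix /nbhs_agree[n xAB]; wlog AB : A B xAB / A < B.
  move=> wl; case: (ltngtP A B) => // [|BA]; first exact: wl.
  by apply/esym/wl => // y /xAB.
case: nix; exists (maxn n B) => y xy; apply: agree_eq => k i _.
have yAB : iter A sg y = iter B sg y by apply: xAB; apply: agreeW xy; lia.
elim/ltn_ind: i => i IHi; have [iB|Bi] := ltnP i B; first by apply: xy; lia.
rewrite -(subnKC Bi) -!iter_sigmaE -yAB -(xAB _ (agreexx _)) !iter_sigmaE.
by apply: IHi; lia.
Qed.

Lemma lp_gt0 x : eventually_periodic x -> 0 < lp x.
Proof. by move=> /lpP[[]]. Qed.

(** A nonzero remainder of [j - i] modulo [lp x] would be a smaller eventual period. *)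
Lemma lp_dvd x i j : i <= j -> iter i sg x = iter j sg x -> lp x %| j - i.
Proof.
rewrite leq_eqVlt => /predU1P[<-|ij xij]; first by rewrite subnn dvdn0.
have /lpP[[p0 [n [m [pnm xnm]]]] pmin] : eventually_periodic x.
  by apply/eventually_periodicP; exists i, j.
set p := lp x in p0 pnm pmin *; pose q := (j - i) %/ p.
have jiE : j - i = q * p + (j - i) %% p by exact: divn_eq.
have xq : iter (q * n) sg x = iter (q * m) sg x.
  elim: (q) => // t IHt.
  by rewrite !mulSn [in LHS]addnC iterD xnm -iterD addnC iterD IHt -iterD.
rewrite /dvdn; case: posnP => // r0.
suff : p <= (j - i) %% p by rewrite leqNgt ltn_mod p0.
(* The exponents differ by [(j - i) - q * (n - m)], which is the remainder. *)
apply: pmin; split => //; exists (q * m + j), (q * n + i); split.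
  have : q * p + q * m = q * n by rewrite -mulnDr; congr (_ * _); lia.
  lia.
by rewrite iterD -xij -iterD addnC iterD -xq -iterD addnC.
Qed.

Lemma lp_period x : eventually_periodic x ->
  exists j, iter (j + lp x) sg x = iter j sg x.
Proof.
move=> /lpP[[p0 [n [m [pnm xnm]]]] _]; exists m.
by rewrite -xnm; congr iter; lia.
Qed.

Lemma periodic_eventually_periodic x p :
  0 < p -> iter p sg x = x -> eventually_periodic x.
Proof. by move=> p0 xp; apply/eventually_periodicP; exists 0, p. Qed.

(** The relation of [lp_period] holds from some [j] on, hence at [j * p], where the orbit is back at
    [x]. *)
Lemma lp_periodic x p : 0 < p -> iter p sg x = x -> iter (lp x) sg x = x.
Proof.
move=> p0 xp.
have [j xj] := lp_period (periodic_eventually_periodic p0 xp).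
have jp : j <= j * p by nia.
rewrite -[RHS](iter_periodic j xp) -{2}(iter_periodic j xp) -iterD.
rewrite -{1 2}(subnK jp) addnCA [lp x + j]addnC iterD xj -iterD.
by rewrite subnK.
Qed.

Lemma lp_tail x y i j : iter i sg x = iter j sg y -> lp x = lp y.
Proof.
suff sub (u v : X) s t : iter s sg u = iter t sg v ->
    eventual_period u `<=` eventual_period v.
  move=> xy; rewrite /lp (_ : eventual_period x = eventual_period y) //.
  by apply/seteqP; split; [exact: sub xy|exact: sub (esym xy)].
move=> uv p [p0 [n [m [pnm unm]]]]; split => //.
exists (n + t), (m + t); split; first by lia.
by rewrite !iterD -uv -!iterD addnC iterD unm -iterD addnC.
Qed.

End OneShift.

(** * Birkhoff sums and the integer cocycle of an orbit equivalence *)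

Section Cocycle.
Variables (a b : finType) (X : sft a) (Y : sft b).
Local Notation sX := (@sigma a X).
Local Notation sY := (@sigma b Y).
Implicit Types (x : X) (k l : X -> nat).

Definition birkhoff_sum (f : X -> nat) i x : nat := \sum_(s < i) f (iter s sX x).

Definition lag k l i x : int :=
  ((birkhoff_sum l i x)%:Z - (birkhoff_sum k i x)%:Z)%R.

Definition orbit_lags (h : X -> Y) k l : Prop :=
  [/\ locally_constant k, locally_constant l &
      forall x, iter (k x) sY (h (sX x)) = iter (l x) sY (h x)].

Lemma birkhoff_sumD f i j x : birkhoff_sum f (i + j) x =
  birkhoff_sum f i x + birkhoff_sum f j (iter i sX x).
Proof.
rewrite /birkhoff_sum big_split_ord; congr (_ + _).
by apply: eq_bigr => s _; rewrite /= addnC iterD.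
Qed.

Lemma birkhoff_sum1 f x : birkhoff_sum f 1 x = f x.
Proof. by rewrite /birkhoff_sum big_ord1. Qed.

Lemma lagD k l i j x : lag k l (i + j) x = (lag k l i x + lag k l j (iter i sX x))%R.
Proof. by rewrite /lag !birkhoff_sumD !PoszD; lia. Qed.

Lemma lag0 k l x : lag k l 0 x = 0%R.
Proof. by rewrite /lag /birkhoff_sum !big_ord0. Qed.

Lemma lagE k l i x :
  (lag k l i x = \sum_(s < i) ((l (iter s sX x))%:Z - (k (iter s sX x))%:Z))%R.
Proof. by rewrite /lag /birkhoff_sum !(big_morph Posz PoszD erefl) sumrB. Qed.

Lemma lag_tail k l i p x :
  iter p sX x = x -> lag k l p (iter i sX x) = lag k l p x.
Proof.
by move=> xp; have := lagD k l i p x; rewrite addnC lagD xp; lia.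
Qed.

Lemma lag_mul k l t p x :
  iter p sX x = x -> lag k l (t * p) x = (t%:Z * lag k l p x)%R.
Proof.
move=> xp; elim: t => [|t IHt]; first by rewrite mul0n lag0 mul0r.
by rewrite mulSn lagD xp IHt; lia.
Qed.

(** Two pairs of exponents of equal degree differ by a common shift, which adds the same term to
    both lags. This makes the degree of the image arrow well defined. *)
Lemma lag_indep k l x x' i j i' j' :
  (i%:Z - j%:Z = i'%:Z - j'%:Z)%R ->
  iter i sX x = iter j sX x' -> iter i' sX x = iter j' sX x' ->
  (lag k l i x - lag k l j x' = lag k l i' x - lag k l j' x')%R.
Proof.
wlog ii' : i j i' j' / i <= i'.
  move=> wl d e e'; have [|/ltnW] := leqP i i' => ii'; first exact: wl.
  by apply/esym; apply: wl => //; exact: esym.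
move=> d e _; rewrite -(subnKC ii') (_ : j' = j + (i' - i)); last by lia.
by rewrite !lagD e; lia.
Qed.

Lemma near_birkhoff_sum f i x : locally_constant f ->
  \forall y \near x, birkhoff_sum f i y = birkhoff_sum f i x.
Proof.
move=> fc; elim: i => [|i IHi].
  by near=> y; rewrite /birkhoff_sum !big_ord0.
near=> y; rewrite -addn1 !birkhoff_sumD !birkhoff_sum1; congr (_ + _).
  by near: y.
by near: y; apply: near_image (@iter_sigma_continuous _ X i) (fc _).
Unshelve. all: by end_near. Qed.

Section OrbitLags.
Variables (h : X -> Y) (k l : X -> nat).
Hypothesis hkl : orbit_lags h k l.

Lemma orbit_lags_iter i x :
  iter (birkhoff_sum k i x) sY (h (iter i sX x)) =
  iter (birkhoff_sum l i x) sY (h x).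
Proof.
have [_ _ kl] := hkl.
elim: i => [|i IHi]; first by rewrite /birkhoff_sum !big_ord0.
rewrite -addn1 !birkhoff_sumD !birkhoff_sum1 iterD addn1 iterS kl -iterD.
by rewrite addnC iterD IHi -iterD addnC.
Qed.

(** The two exponents differ by [lag k l i x - lag k l j x'], the degree of the image arrow. *)
Lemma orbit_lags_tail i j x x' : iter i sX x = iter j sX x' ->
  iter (birkhoff_sum k j x' + birkhoff_sum l i x) sY (h x) =
  iter (birkhoff_sum k i x + birkhoff_sum l j x') sY (h x').
Proof.
move=> e; rewrite iterD -orbit_lags_iter e -iterD.
by rewrite addnC iterD orbit_lags_iter -iterD.
Qed.

Lemma lp_orbit_lags i x : lp (h (iter i sX x)) = lp (h x).
Proof. exact: lp_tail (orbit_lags_iter i x). Qed.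

End OrbitLags.
End Cocycle.

(** * The lags of a homeomorphism at non-isolated and at isolated points *)

Section Homeo.
Variables (a b : finType) (X : sft a) (Y : sft b).
Local Notation sX := (@sigma a X).
Local Notation sY := (@sigma b Y).
Variables (h : X -> Y) (h' : Y -> X).
Hypotheses (hK : cancel h h') (h'K : cancel h' h).
Hypotheses (hc : continuous h) (h'c : continuous h').
Implicit Types x : X.

Lemma isolated_homeo x : is_isolated x -> is_isolated (h x).
Proof.
move=> [n xn]; have /nbhs_agree[m xm] : \forall y \near h x, agree n x (h' y).
  by apply: h'c; rewrite hK; exact: near_agree.
by exists m => y /xm/xn <-.
Qed.

Section OrbitLags.
Variables (k l : X -> nat).
Hypothesis hkl : orbit_lags h k l.

(* If [l_p(x) <= k_p(x)], a small neighbourhood of [h x] would be mapped into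
   itself by [h \o sigma^p \o h'], so a neighbourhood of [x] would stay close to [x]
   under all iterates of [sigma^p], contradicting expansivity. *)
Lemma nonisolated_lag_gt0 x p : ~ is_isolated x -> 0 < p -> iter p sX x = x ->
  birkhoff_sum k p x < birkhoff_sum l p x.
Proof.
move=> nix p0 xp; rewrite ltnNge; apply/negP.
set A := birkhoff_sum l p x; set B := birkhoff_sum k p x => AB; apply: nix.
have [kc lc _] := hkl.
have ABx : iter A sY (h x) = iter B sY (h x).
  by rewrite -(orbit_lags_iter hkl) xp.
have hp : \forall u \near iter p sX x, agree B (h x) (h u).
  by rewrite xp; apply: near_image hc _; exact: near_agree.
have near_x : \forall y \near x, [/\ agree p x y, agree B (h x) (h (iter p sX y)) &
    iter A sY (h y) = iter B sY (h (iter p sX y))].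
  near=> y; split.
  - by near: y; exact: near_agree.
  - by near: y; exact: near_image (@iter_sigma_continuous _ X p) hp.
  - have <- : birkhoff_sum l p y = A by near: y; exact: near_birkhoff_sum.
    have <- : birkhoff_sum k p y = B by near: y; exact: near_birkhoff_sum.
    by rewrite -(orbit_lags_iter hkl).
have /nbhs_agree[n0 xn0] : \forall y \near h x, agree p x (h' y) /\
    agree B (h x) (h (iter p sX (h' y))) /\
    iter A sY y = iter B sY (h (iter p sX (h' y))).
  have := near_x; rewrite -{1}[x]hK => /(near_image h'c); apply: filterS => y.
  by rewrite h'K => -[].
pose n := A + n0.
(* [A] coordinates are dropped and [B] are put in front; since [A <= B], the agreement does not get
   shorter. *)
have step y : agree n (h x) (h y) -> agree n (h x) (h (iter p sX y)).
  move=> xy; have := xn0 _ (agreeW (leq_addl _ _) xy); rewrite hK => -[_ [xyB e]].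
  have : agree (B + n0) (h x) (h (iter p sX y)).
    by apply: agree_cat => //; rewrite -e -ABx; exact: agree_iter.
  by apply: agreeW; rewrite leq_add2r.
have /nbhs_agree[m xm] : \forall y \near x, agree n (h x) (h y).
  by apply: near_image hc _; exact: near_agree.
exists m => y xy; apply: agree_eq => i0 i _.
(* Hence [y] agrees with [x] on every block of [p] coordinates; coordinate [i] lies in block
   [i %/ p]. *)
have stay t : agree n (h x) (h (iter (t * p) sX y)).
  by elim: t => [|t IHt]; [exact: xm|rewrite mulSn iterD; exact: step].
have := xn0 _ (agreeW (leq_addl _ _) (stay (i %/ p))); rewrite hK => -[xyp _].
have := xyp _ (ltn_pmod i p0).
by rewrite -{1}(iter_periodic (i %/ p) xp) !iter_sigmaE -divn_eq.
Unshelve. all: by end_near. Qed.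

(** Isolation is a topological property, which settles isolated points; elsewhere the strict
    inequality of the sums over one period gives two different exponents. *)
Lemma orbit_lags_eventually_periodic x :
  eventually_periodic x -> eventually_periodic (h x).
Proof.
have [isox _|nix [n [p p0 xp]]] := pselect (is_isolated x).
  exact/eventually_periodicP/isolated_eventually_periodic/isolated_homeo.
have nixn : ~ is_isolated (iter n sX x) by move/isolated_iter.
have lt := nonisolated_lag_gt0 nixn p0 xp.
have e := orbit_lags_iter hkl p (iter n sX x); rewrite xp in e.
apply/eventually_periodicP.
exists (birkhoff_sum k p (iter n sX x) + birkhoff_sum l n x).
exists (birkhoff_sum l p (iter n sX x) + birkhoff_sum l n x).
split; first by rewrite ltn_add2r.
rewrite !iterD -(orbit_lags_iter hkl) -!iterD addnC iterD e -iterD.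
by rewrite addnC.
Qed.

Variables (k' l' : Y -> nat).
Hypothesis hkl' : orbit_lags h' k' l'.

(* The composite of the homomorphisms induced by [h] and [h'] preserves degrees
   over non-isolated points. *)
Lemma nonisolated_lagK x n : ~ is_isolated x ->
  (lag k' l' (birkhoff_sum l n x) (h x) -
   lag k' l' (birkhoff_sum k n x) (h (iter n sX x)) = n%:Z)%R.
Proof.
move=> nix; have [kc lc _] := hkl; have [kc' lc' _] := hkl'.
set A := birkhoff_sum l n x; set B := birkhoff_sum k n x.
suff : birkhoff_sum k' B (h (iter n sX x)) + birkhoff_sum l' A (h x) =
    birkhoff_sum k' A (h x) + birkhoff_sum l' B (h (iter n sX x)) + n.
  by rewrite /lag; lia.
(* The two sides are exponents of [sigma] that agree at every point near [x], all the sums being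
   locally constant. *)
apply: locally_preperiodic_isolated nix _.
have near_h f i : locally_constant f ->
    \forall y \near x, birkhoff_sum f i (h y) = birkhoff_sum f i (h x).
  by move=> fc; exact: near_image hc (near_birkhoff_sum i (h x) fc).
have near_hn f i : locally_constant f -> \forall y \near x,
    birkhoff_sum f i (h (iter n sX y)) = birkhoff_sum f i (h (iter n sX x)).
  move=> fc; have := near_birkhoff_sum i (h (iter n sX x)) fc.
  by move=> /(near_image hc)/(near_image (@iter_sigma_continuous _ X n)).
near=> y.
have Ay : birkhoff_sum l n y = A by near: y; exact: near_birkhoff_sum.
have By : birkhoff_sum k n y = B by near: y; exact: near_birkhoff_sum.
have e : iter A sY (h y) = iter B sY (h (iter n sX y)).
  by rewrite -Ay -By (orbit_lags_iter hkl).
have := orbit_lags_tail hkl' e; rewrite !hK -iterD.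
have -> : birkhoff_sum k' A (h y) = birkhoff_sum k' A (h x).
  by near: y; exact: near_h.
have -> : birkhoff_sum l' A (h y) = birkhoff_sum l' A (h x).
  by near: y; exact: near_h.
have -> : birkhoff_sum k' B (h (iter n sX y)) = birkhoff_sum k' B (h (iter n sX x)).
  by near: y; exact: near_hn.
have -> : birkhoff_sum l' B (h (iter n sX y)) = birkhoff_sum l' B (h (iter n sX x)).
  by near: y; exact: near_hn.
by [].
Unshelve. all: by end_near. Qed.

End OrbitLags.
End Homeo.

(** The lag over [lp x] is [t * lp (h x)], and the inverse takes [lp (h x)] to [r * lp x]. Degrees
    are preserved by the composite, so [t * r = 1]. *)
Lemma nonisolated_lag_lp (a b : finType) (X : sft a) (Y : sft b)
    (h : X -> Y) (h' : Y -> X) (k l : X -> nat) (k' l' : Y -> nat) (x : X) :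
  cancel h h' -> cancel h' h -> continuous h -> continuous h' ->
  orbit_lags h k l -> orbit_lags h' k' l' ->
  ~ is_isolated x -> 0 < lp x -> iter (lp x) (@sigma a X) x = x ->
  (lag k l (lp x) x = (lp (h x))%:Z)%R.
Proof.
move=> hK h'K hc h'c hkl hkl' nix p0 xp; set p := lp x in p0 xp *.
have := nonisolated_lagK hK hc hkl hkl' p nix.
have := nonisolated_lag_gt0 hK h'K hc h'c hkl nix p0 xp.
have := orbit_lags_iter hkl p x; rewrite xp.
set A := birkhoff_sum l p x; set B := birkhoff_sum k p x => ABx BA.
have ehx : eventually_periodic (h x) by apply/eventually_periodicP; exists B, A.
have /dvdnP[t tE] := lp_dvd (ltnW BA) ABx.
have [j xj] := lp_period ehx; have q0 := lp_gt0 ehx.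
set q := lp (h x) in tE xj q0 *.
set y := h x in ABx ehx xj *.
rewrite -(subnKC (ltnW BA)) tE lagD.
(* [h x] need not be periodic, so the lag of the inverse is computed at a point [z] of its orbit
   with period [q]. *)
pose z := iter (j + B) (@sigma b Y) y.
have zE : z = iter j (@sigma b Y) (iter B (@sigma b Y) y) by rewrite -iterD.
have up : iter (t * q) (@sigma b Y) (iter B (@sigma b Y) y) =
    iter B (@sigma b Y) y.
  by rewrite -iterD -tE subnK// ltnW.
have zq : iter q (@sigma b Y) z = z.
  by rewrite /z -iterD addnA addnC [q + j]addnC iterD xj -iterD addnC.
rewrite -(lag_tail k' l' j up) -zE lag_mul//.
have niz : ~ is_isolated z.
  by rewrite zE -iterD => /isolated_iter/(isolated_homeo h'K hK hc); rewrite hK.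
have := nonisolated_lag_gt0 h'K hK h'c hc hkl' niz q0 zq.
have := orbit_lags_iter hkl' q z; rewrite zq => e lt.
have /dvdnP[r rE] := lp_dvd (ltnW lt) e.
have hzx : lp (h' z) = p by rewrite /z (lp_orbit_lags hkl') /y hK.
rewrite hzx in rE; have -> : (lag k' l' q z = (r * p)%:Z)%R by rewrite /lag; lia.
rewrite addrAC subrr add0r -PoszM => -[trp].
have /andP[/eqP t1 _] : (t == 1) && (r == 1).
  by rewrite -muln_eq1 -(eqn_pmul2r p0) mul1n -mulnA trp.
by rewrite /lag -/A -/B; move: tE BA; rewrite t1; lia.
Qed.

(** [P] is open, closed and discrete, so any values on it keep the lags locally constant; [c x] can
    be any degree of an arrow from [h (sigma x)] to [h x]. *)
Lemma adjust_orbit_lags (a b : finType) (X : sft a) (Y : sft b) (h : X -> Y)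
    (k l : X -> nat) (P : set X) (c : X -> int) :
  orbit_lags h k l -> (forall x, P x -> is_isolated x) ->
  (forall x, ~ P x -> \forall y \near x, ~ P y) ->
  (forall x, P x -> exists i j, (c x = i%:Z - j%:Z)%R /\
     iter i (@sigma b Y) (h x) = iter j (@sigma b Y) (h (sigma x))) ->
  exists k1 l1, orbit_lags h k1 l1 /\ forall x,
    ((l1 x)%:Z - (k1 x)%:Z = if `[< P x >] then c x else (l x)%:Z - (k x)%:Z)%R.
Proof.
move=> [kc lc kl] Piso PC Pc.
(* Off [P] the pair itself is prescribed, not just its difference, so that it stays locally
   constant. *)
have /choice[f fP] x : exists ij : nat * nat,
    (((ij.1)%:Z - (ij.2)%:Z = if `[< P x >] then c x else (l x)%:Z - (k x)%:Z)%R /\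
     iter ij.1 (@sigma b Y) (h x) = iter ij.2 (@sigma b Y) (h (sigma x))) /\
    (~ P x -> ij = (l x, k x)).
  have [Px|nPx] := pselect (P x).
    have [i [j [cE ij]]] := Pc x Px; exists (i, j).
    by split => //; split => //; case: asboolP.
  by exists (l x, k x); split => //; split; [case: asboolP|rewrite kl].
have fc : locally_constant f.
  move=> x; have [Px|nPx] := pselect (P x).
    have [n xn] := Piso x Px; apply/nbhs_agree; exists n => y xy.
    by rewrite (xn y xy).
  near=> y; have nPy : ~ P y by near: y; exact: PC.
  rewrite (fP y).2// (fP x).2//; congr (_, _); near: y; first exact: lc.
  exact: kc.
exists (fun x => (f x).2), (fun x => (f x).1); split; last first.
  by move=> x; case: (fP x) => -[].
split; do 1?[by move=> x; apply: filterS (fc x) => y ->].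
by move=> x; case: (fP x) => -[_ ->].
Unshelve. all: by end_near. Qed.

(** * A representative on each periodic orbit, and the normalized lags *)

Section Representatives.
Variables (a : finType) (X : sft a).
Local Notation sg := (@sigma a X).

Definition forward_orbit (x : X) : set X := [set y | exists s, iter s sg x = y].

(** The default [x] of [xget] is never reached, so the choice depends only on the orbit as a set. *)
Definition orbit_repr (x : X) : X := xget x (forward_orbit x).

Lemma orbit_repr_mem x : exists s, iter s sg x = orbit_repr x.
Proof. exact: (@xgetI _ x (forward_orbit x) x (ex_intro _ 0 erefl)). Qed.

Lemma orbit_repr_iter x p s : 0 < p -> iter p sg x = x ->
  orbit_repr (iter s sg x) = orbit_repr x.
Proof.
move=> p0 xp; rewrite /orbit_repr.
have -> : forward_orbit (iter s sg x) = forward_orbit x.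
  apply/seteqP; split=> _ [t <-]; first by exists (t + s); rewrite iterD.
  exists (t + (s * p - s)); rewrite -iterD -addnA subnK; last by nia.
  by rewrite iterD iter_periodic.
rewrite /xget; case: pselect => // nx.
by case: nx; exists x; apply/asboolP; exists 0.
Qed.

(** Used to see that one period meets the representative only once. *)
Lemma iter_lp_inj x i j : i < lp x -> j < lp x ->
  iter i sg x = iter j sg x -> i = j.
Proof.
wlog ij : i j / i <= j.
  by move=> wl ix jx e; have [|/ltnW] := leqP i j => ij;
    [apply: wl|apply/esym/wl].
move=> ix jx /(lp_dvd ij); rewrite /dvdn modn_small; first by lia.
exact: leq_ltn_trans (leq_subr _ _) jx.
Qed.

End Representatives.

(** The defect [d x] over one period is added at the representative only, so each period receives it
    exactly once. *)
Lemma normalized_orbit_lags (a b : finType) (X : sft a) (Y : sft b)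
    (h : X -> Y) (h' : Y -> X) (k l : X -> nat) (k' l' : Y -> nat) :
  cancel h h' -> cancel h' h -> continuous h -> continuous h' ->
  orbit_lags h k l -> orbit_lags h' k' l' ->
  exists k1 l1, orbit_lags h k1 l1 /\
    forall x, 0 < lp x -> iter (lp x) (@sigma a X) x = x ->
      (lag k1 l1 (lp x) x = (lp (h x))%:Z)%R.
Proof.
move=> hK h'K hc h'c hkl hkl'.
pose P := [set x : X | is_isolated x /\ 0 < lp x /\ iter (lp x) (@sigma a X) x = x].
have lp_iter s (x : X) : lp (iter s (@sigma a X) x) = lp x.
  exact: (@lp_tail _ _ _ _ 0 s).
have P_iter s x : P x -> P (iter s (@sigma a X) x).
  move=> [xi [p0 xp]]; split; first exact/isolated_iter.
  by rewrite lp_iter; split => //; rewrite -iterD addnC iterD xp.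
pose d x : int := ((lp (h x))%:Z - lag k l (lp x) x)%R.
pose c x : int := (lag k l 1 x + (if x == orbit_repr x then d x else 0))%R.
have [||x [_ [p0 xp]]|k1 [l1 [hkl1 kl1]]] :=
  @adjust_orbit_lags _ _ _ _ h k l P c hkl.
- by move=> x [].
(* A point of [P] in the [m]-cylinder of [x] has [x] in its own [m]-cylinder, hence equals [x]. *)
- have [m mP] := isolated_periodic_cylinder X => x nPx.
  apply/nbhs_agree; exists m => y xy [yi [p0 yp]].
  have yx : agree m y x by move=> i im; rewrite xy.
  by apply: nPx; rewrite (mP _ _ yi p0 yp _ yx).
- have ehx : eventually_periodic (h x).
    apply: orbit_lags_eventually_periodic hkl _ _ => //.
    exact: periodic_eventually_periodic p0 xp.
  (* [c x] is shown to be a degree by composing arrows: one over a step of [sigma], and loops at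
     [h x] of degrees [lp (h x)] and minus the old lag. *)
  have e1 : exists i j : nat, (lag k l 1 x = i%:Z - j%:Z)%R /\
      iter i (@sigma b Y) (h x) = iter j (@sigma b Y) (h (sigma x)).
    by do 2?eexists; split; last exact/esym/(orbit_lags_iter hkl 1).
  have e2 : exists i j : nat, (lag k l (lp x) x = i%:Z - j%:Z)%R /\
      iter i (@sigma b Y) (h x) = iter j (@sigma b Y) (h x).
    do 2?eexists; split; first by [].
    by rewrite -(orbit_lags_iter hkl) xp.
  have e3 : exists i j : nat, (d x = i%:Z - j%:Z)%R /\
      iter i (@sigma b Y) (h x) = iter j (@sigma b Y) (h x).
    exact: (@mul_arrowP _ _ (lp_arrow ehx) (inv_arrow (SftArrow e2)) erefl).
  rewrite /c; case: ifP => _; last by rewrite addr0.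
  by rewrite addrC; exact: (@mul_arrowP _ _ (SftArrow e3) (SftArrow e1) erefl).
exists k1, l1; split => // x p0 xp; rewrite lagE.
have [xi|nix] := pselect (is_isolated x); last first.
  rewrite -(nonisolated_lag_lp hK h'K hc h'c hkl hkl' nix p0 xp) lagE.
  by apply: eq_bigr => s _; rewrite kl1; case: asboolP => // -[/isolated_iter].
have [s0 s0E] := orbit_repr_mem x.
pose s1 := Ordinal (ltn_pmod s0 p0).
have s1E : iter s1 (@sigma a X) x = orbit_repr x.
  by rewrite -s0E {1}(divn_eq s0 (lp x)) addnC iterD iter_periodic.
have term s : ((l1 (iter s (@sigma a X) x))%:Z - (k1 (iter s (@sigma a X) x))%:Z =
    ((l (iter s (@sigma a X) x))%:Z - (k (iter s (@sigma a X) x))%:Z) +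
    (if iter s (@sigma a X) x == orbit_repr x then d x else 0))%R.
  rewrite kl1 (_ : `[< _ >] = true); last by apply/asboolP/P_iter.
  rewrite /c (orbit_repr_iter _ p0 xp) lagE big_ord1; congr (_ + _)%R.
  by rewrite /d lp_iter (lp_orbit_lags hkl) lag_tail.
under eq_bigr do rewrite term.
rewrite big_split /= -lagE (bigD1 s1)//= s1E eqxx big1 ?addr0.
  by rewrite /d; lia.
move=> s ss1; case: eqP => // e; case/eqP: ss1; apply: val_inj.
by apply: (iter_lp_inj (ltn_ord s) (ltn_ord s1)); rewrite e s1E.
Qed.

(** * Neighbourhoods of an arrow *)

Section ArrowTopology.
Variables (a : finType) (X : sft a).
Local Notation sg := (@sigma a X).
Implicit Types g : sft_arrow X.

Definition arrow_tube i j n g : set (sft_arrow X) :=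
  [set f | [/\ adeg f = adeg g, agree n (arng g) (arng f),
    agree n (asrc g) (asrc f) & iter i sg (arng f) = iter j sg (asrc f)]].

(* If [i < i'], the coordinates from [i] to [i'] of [y], and of [y'] from [j] to
   [j'], are those of [x] and [x']. *)
Lemma iter_sigma_lift (x x' y y' : X) i j i' j' :
  (i%:Z - j%:Z = i'%:Z - j'%:Z)%R -> iter i sg x = iter j sg x' ->
  agree i' x y -> agree j' x' y' -> iter i' sg y = iter j' sg y' ->
  iter i sg y = iter j sg y'.
Proof.
move=> d e xy xy' e'; have [ii'|/ltnW i'i] := leqP i i'; last first.
  rewrite -(subnK i'i) (_ : j = (i - i') + j'); last by lia.
  by rewrite !iterD e'.
apply/esym/(@agree_inj _ _ (i' - i)); last first.
  rewrite -!iterD subnK// e'; congr iter; lia.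
have xyi : agree (i' - i) (iter i sg x) (iter i sg y).
  by apply: agree_iter; rewrite subnKC.
have xyj : agree (i' - i) (iter j sg x') (iter j sg y').
  by apply: agree_iter; apply: agreeW xy'; lia.
by move=> s si; rewrite xyj// -e xyi.
Qed.

(** One fixed pair of exponents suffices: a basic set around [g] with other exponents contains a
    tube by [iter_sigma_lift]. *)
Lemma nbhs_arrow g i j (W : set (sft_arrow X)) :
  (adeg g = i%:Z - j%:Z)%R -> iter i sg (arng g) = iter j sg (asrc g) ->
  nbhs g W <-> exists n, arrow_tube i j n g `<=` W.
Proof.
move=> dg eg; split=> [|[n nW]].
  rewrite nbhsE => -[O [oO Og] OW].
  have [B [[i0 [j0 [U [U' [-> [oU oU' _ _ _]]]]]] [d0 Ug U'g e0] BO]] :=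
    (open_sft_arrowP O).1 oO g Og.
  have /nbhs_agree[n nU] : nbhs (arng g) U by exact: open_nbhs_nbhs.
  have /nbhs_agree[n' nU'] : nbhs (asrc g) U' by exact: open_nbhs_nbhs.
  exists (maxn (maxn i j) (maxn n n')) => f [df rf sf ef].
  apply/OW/BO; split.
  - by rewrite df.
  - by apply: nU; apply: agreeW rf; lia.
  - by apply: nU'; apply: agreeW sf; lia.
  - apply: (@iter_sigma_lift (arng g) (asrc g) _ _ _ _ i j) => //.
    + by rewrite -dg -d0.
    + by apply: agreeW rf; lia.
    + by apply: agreeW sf; lia.
(* Length at least [i] and [j] makes both iterates injective on the cylinders. *)
pose m := maxn n (maxn i j).
pose B := sft_basic i j [set y : X | cylinder m (set_val (arng g)) (set_val y)]
  [set y : X | cylinder m (set_val (asrc g)) (set_val y)].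
have bB : sft_basis B.
  apply: sft_basic_in_basis; try exact: open_cylinder.
    move=> y z /set_mem yx /set_mem zx; apply: (@iter_sigma_inj _ _ i (arng g)).
      by apply/mem_set; apply: agreeW yx; lia.
    by apply/mem_set; apply: agreeW zx; lia.
  move=> y z /set_mem yx /set_mem zx; apply: (@iter_sigma_inj _ _ j (asrc g)).
    by apply/mem_set; apply: agreeW yx; lia.
  by apply/mem_set; apply: agreeW zx; lia.
rewrite nbhsE; exists B; last first.
  move=> f [df rf sf ef]; apply: nW; split => //; first by rewrite df.
    by apply: agreeW rf; lia.
  by apply: agreeW sf; lia.
split; last by split.
by apply/open_sft_arrowP => f Bf; exists B; split.
Qed.

End ArrowTopology.

(** * The groupoid homomorphism induced by [h] *)

Section ArrowMap.
Variables (a b : finType) (X : sft a) (Y : sft b).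
Local Notation sX := (@sigma a X).
Local Notation sY := (@sigma b Y).
Variables (h : X -> Y) (k l : X -> nat).
Hypothesis hkl : orbit_lags h k l.
Implicit Types f g : sft_arrow X.

(** The exponents are only known to exist, so a pair is chosen; [arrow_lagE] removes the dependence
    on it. *)
Lemma arrow_witness g : {ij : nat * nat | (adeg g = ij.1%:Z - ij.2%:Z)%R /\
  iter ij.1 sX (arng g) = iter ij.2 sX (asrc g)}.
Proof. by apply: cid; have [i [j ?]] := arrowP g; exists (i, j). Qed.

Definition arrow_lag g : int :=
  (lag k l (sval (arrow_witness g)).1 (arng g) -
   lag k l (sval (arrow_witness g)).2 (asrc g))%R.

Lemma arrow_lagE g i j : (adeg g = i%:Z - j%:Z)%R ->
  iter i sX (arng g) = iter j sX (asrc g) ->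
  arrow_lag g = (lag k l i (arng g) - lag k l j (asrc g))%R.
Proof.
move=> dg eg; have [dw ew] := svalP (arrow_witness g).
by apply: lag_indep => //; rewrite -dw.
Qed.

Lemma map_arrowP g : exists i j : nat, (arrow_lag g = i%:Z - j%:Z)%R /\
  iter i sY (h (arng g)) = iter j sY (h (asrc g)).
Proof.
have [_ ew] := svalP (arrow_witness g).
do 2?eexists; split; last exact: (orbit_lags_tail hkl ew).
by rewrite /arrow_lag /lag !PoszD; lia.
Qed.

Definition map_arrow g : sft_arrow Y := SftArrow (map_arrowP g).

Lemma map_arrow_lift g i j : (adeg g = i%:Z - j%:Z)%R ->
  iter i sX (arng g) = iter j sX (asrc g) ->
  (adeg (map_arrow g) =
   (birkhoff_sum k j (asrc g) + birkhoff_sum l i (arng g))%:Z -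
   (birkhoff_sum k i (arng g) + birkhoff_sum l j (asrc g))%:Z)%R.
Proof. by move=> dg eg; rewrite /= (arrow_lagE dg eg) /lag !PoszD; lia. Qed.

Lemma map_arrow_mul f g (fg : asrc f = arng g)
    (hfg : asrc (map_arrow f) = arng (map_arrow g)) :
  map_arrow (mul_arrow fg) = mul_arrow hfg.
Proof.
apply: sft_arrow_inj => //=.
have [i [j [df ef]]] := arrowP f; have [i' [j' [dg eg]]] := arrowP g.
have e : iter (i + i') sX (arng f) = iter (j' + j) sX (asrc g).
  by rewrite addnC iterD ef fg -iterD addnC iterD eg -iterD addnC.
have d : (adeg (mul_arrow fg) = (i + i')%:Z - (j' + j)%:Z)%R.
  by rewrite /= df dg !PoszD; lia.
rewrite (arrow_lagE d e) (arrow_lagE df ef) (arrow_lagE dg eg) /=.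
rewrite !lagD ef -eg fg.
(* The mixed terms cancel by expanding the lag of [j + i'] at the middle point in both orders. *)
by have := lagD k l j i' (arng g); rewrite addnC lagD; lia.
Qed.

Hypothesis hc : continuous h.

Lemma map_arrow_continuous : continuous map_arrow.
Proof.
move=> g W; have [i [j [dg eg]]] := arrowP g; have [kc lc _] := hkl.
move=> /(nbhs_arrow _ (map_arrow_lift dg eg) (orbit_lags_tail hkl eg))[n nW].
have near_end x i0 : \forall y \near x, [/\ agree n (h x) (h y),
    birkhoff_sum k i0 y = birkhoff_sum k i0 x &
    birkhoff_sum l i0 y = birkhoff_sum l i0 x].
  have hn : \forall y \near x, agree n (h x) (h y).
    by apply: near_image hc _; exact: near_agree.
  near=> y; split; near: y; [exact: hn|exact: near_birkhoff_sum..].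
have /nbhs_agree[m mr] := near_end (arng g) i.
have /nbhs_agree[m' ms] := near_end (asrc g) j.
apply/(nbhs_arrow _ dg eg); exists (maxn m m') => f [df rf sf ef].
have [hr kr lr] := mr _ (agreeW (leq_maxl m m') rf).
have [hs ks ls] := ms _ (agreeW (leq_maxr m m') sf).
have dg' := dg; rewrite -df in dg'.
apply: nW; split => //.
  by rewrite (map_arrow_lift dg' ef) (map_arrow_lift dg eg) kr lr ks ls.
by rewrite -kr -ks -lr -ls; exact: (orbit_lags_tail hkl ef).
Unshelve. all: by end_near. Qed.

(* An arrow close to [map_arrow g] is determined by its range, and the arrow close
   to [g] with the corresponding range is mapped to it. *)
Lemma map_arrow_open (h' : Y -> X) g (W : set (sft_arrow X)) :
  cancel h h' -> cancel h' h -> continuous h' ->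
  nbhs g W -> nbhs (map_arrow g) (map_arrow @` W).
Proof.
move=> hK h'K h'c gW; have [i [j [dg eg]]] := arrowP g.
have dg' := map_arrow_lift dg eg; have eg' := orbit_lags_tail hkl eg.
set A := (X in iter X _ (h (arng g)) = _) in eg' dg'.
set B := (X in _ = iter X _ (h (asrc g))) in eg' dg'.
(* Tube length [B] is what lets [sigma^B] determine the source. *)
have gT : nbhs g (map_arrow @^-1` arrow_tube A B B (map_arrow g)).
  apply: map_arrow_continuous.
  by apply/(nbhs_arrow _ dg' eg'); exists B.
have gWT : nbhs g (W `&` map_arrow @^-1` arrow_tube A B B (map_arrow g)).
  exact: filterI.
have [n nWT] := (nbhs_arrow _ dg eg).1 gWT.
have [n' n'x] : exists n', forall y, agree n' (h (arng g)) y ->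
    agree n (arng g) (h' y) /\
    exists2 x', agree n (asrc g) x' & iter j sX x' = iter i sX (h' y).
  pose C := [set y : X | cylinder n (set_val (asrc g)) (set_val y)].
  (* Openness of [sigma^j] supplies a source for the lifted arrow. *)
  have near_i : \forall u \near iter i sX (arng g), (iter j sX @` C) u.
    apply: open_nbhs_nbhs; split; first exact/iter_sigma_open/open_cylinder.
    by rewrite eg; exists (asrc g).
  have near_x : \forall x \near h' (h (arng g)), agree n (arng g) x /\
      (iter j sX @` C) (iter i sX x).
    rewrite hK; near=> x; split; near: x; first exact: near_agree.
    exact: near_image (@iter_sigma_continuous _ X i) near_i.
  apply/nbhs_agree; apply: filterS (near_image h'c near_x).
  move=> y [xy [x' Cx' e]].
  by split => //; exists x'.
apply/(nbhs_arrow _ dg' eg'); exists (maxn n' B) => f [df rf sf ef].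
have [rx [x' sx e]] := n'x _ (agreeW (leq_maxl n' B) rf).
have P : exists i j : nat, (adeg g = i%:Z - j%:Z)%R /\
    iter i sX (h' (arng f)) = iter j sX x' by exists i, j.
pose f0 := SftArrow P.
have [Wf0 [df0 _ sf0 ef0]] :
    (W `&` map_arrow @^-1` arrow_tube A B B (map_arrow g)) f0.
  by apply: nWT; split.
exists f0 => //; apply: sft_arrow_inj.
- by rewrite /= h'K.
- by rewrite df0 df.
- apply: (@agree_inj _ _ B).
    by move=> s sB; rewrite sf0// sf//; lia.
  by rewrite -ef0 -ef /= h'K.
Unshelve. all: by end_near. Qed.

End ArrowMap.

(** * Bijectivity of the homomorphism with normalized lags *)

Section NormalizedMap.
Variables (a b : finType) (X : sft a) (Y : sft b).
Local Notation sX := (@sigma a X).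
Local Notation sY := (@sigma b Y).
Variables (h : X -> Y) (h' : Y -> X) (k l : X -> nat).
Hypotheses (hK : cancel h h') (h'K : cancel h' h).
Hypothesis hkl : orbit_lags h k l.
Hypothesis hlp : forall x, 0 < lp x -> iter (lp x) sX x = x ->
  (lag k l (lp x) x = (lp (h x))%:Z)%R.

Lemma lag_lp_tail x j : 0 < lp x -> iter (j + lp x) sX x = iter j sX x ->
  (lag k l (lp x) (iter j sX x) = (lp (h x))%:Z)%R.
Proof.
have lpj : lp (iter j sX x) = lp x by exact: (@lp_tail _ _ _ _ 0 j).
rewrite -(lp_orbit_lags hkl j) -lpj => p0 xj; apply: hlp => //.
by rewrite -iterD addnC.
Qed.

Lemma normalized_lag_neq0 u n : eventually_periodic (h u) ->
  0 < n -> iter n sX u = u -> lag k l n u <> 0%R.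
Proof.
move=> ehu n0 un; have q0 := lp_gt0 ehu.
have p0 := lp_gt0 (periodic_eventually_periodic n0 un).
have /dvdnP[t] : lp u %| n - 0 by apply: lp_dvd.
rewrite subn0 => nE; have up := lp_periodic n0 un.
by rewrite nE lag_mul// hlp//; nia.
Qed.

Hypothesis hper :
  forall x, eventually_periodic x -> eventually_periodic (h x).

Lemma normalized_lag_inj x i j : iter i sX x = iter j sX x ->
  lag k l i x = lag k l j x -> i = j.
Proof.
wlog ij : i j / i < j.
  move=> wl e le; case: (ltngtP i j) => // ij; first exact: wl.
  by apply/esym/wl.
move=> e le; have un : iter (j - i) sX (iter i sX x) = iter i sX x.
  by rewrite -iterD subnK// ltnW.
case: (@normalized_lag_neq0 (iter i sX x) (j - i)); rewrite ?subn_gt0//.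
  by apply/hper; apply: periodic_eventually_periodic un; rewrite subn_gt0.
by have := lagD k l i (j - i) x; rewrite subnKC 1?ltnW// le; lia.
Qed.

(** Two arrows with equal ends differ by a loop, and a loop of lag zero is trivial. *)
Lemma normalized_map_arrow_inj : injective (map_arrow hkl).
Proof.
move=> f g fg.
have rfg : arng f = arng g.
  by apply: (can_inj hK); have := congr1 (@arng b Y) fg.
have sfg : asrc f = asrc g.
  by apply: (can_inj hK); have := congr1 (@asrc b Y) fg.
apply: sft_arrow_inj => //; have /= := congr1 (@adeg b Y) fg.
have [i [j [df ef]]] := arrowP f; have [i' [j' [dg eg]]] := arrowP g.
rewrite (arrow_lagE k l df ef) (arrow_lagE k l dg eg) df dg.
rewrite rfg sfg in ef *; set x := arng g in ef eg *; set x' := asrc g in ef eg *.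
move=> lE; suff : j + i' = j' + i by lia.
apply: (@normalized_lag_inj x').
  by rewrite addnC iterD -ef -iterD addnC iterD eg -iterD addnC.
have := lagD k l i i' x; rewrite [in LHS]addnC !lagD ef eg; lia.
Qed.

(** [h'] gives some arrow between the right ends. The degree of its image is off by a multiple of
    [lp (arng f)], corrected by as many turns around the cycle of [x]. *)
Lemma normalized_map_arrow_surj (k' l' : Y -> nat) :
  orbit_lags h' k' l' ->
  (forall y, eventually_periodic y -> eventually_periodic (h' y)) ->
  forall f, exists g, map_arrow hkl g = f.
Proof.
move=> hkl' h'per f; have [A [B [df ef]]] := arrowP f.
set x := h' (arng f); set x' := h' (asrc f).
have [i [j e]] : exists i j, iter i sX x = iter j sX x'.
  by do 2?eexists; exact: (orbit_lags_tail hkl' ef).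
suff [i2 [j2 [e2 d2]]] : exists i2 j2, iter i2 sX x = iter j2 sX x' /\
    (lag k l i2 x - lag k l j2 x' = adeg f)%R.
  have P : exists i j : nat, (i2%:Z - j2%:Z = i%:Z - j%:Z)%R /\
      iter i sX x = iter j sX x' by exists i2, j2.
  exists (SftArrow P); apply: sft_arrow_inj; [exact: h'K| |exact: h'K].
  by rewrite /= (@arrow_lagE _ _ k l (SftArrow P) i2 j2).
have := orbit_lags_tail hkl e; rewrite !h'K.
set A0 := (_ + _); set B0 := (_ + _) => e0.
have d0 : (lag k l i x - lag k l j x' = A0%:Z - B0%:Z)%R.
  by rewrite /lag /A0 /B0; lia.
have loop : iter (B + A0) sY (arng f) = iter (B0 + A) sY (arng f).
  by rewrite iterD e0 -iterD addnC iterD -ef -iterD.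
have [AB|AB] := eqVneq (B + A0) (B0 + A).
  by exists i, j; split => //; rewrite d0 df; lia.
have ey : eventually_periodic (arng f).
  apply/eventually_periodicP; case: (ltngtP (B + A0) (B0 + A)) AB => // lt _.
    by exists (B + A0), (B0 + A).
  by exists (B0 + A), (B + A0).
have ex := h'per _ ey.
have p0 := lp_gt0 ex; have [s xs] := lp_period ex; rewrite -/x in p0 xs.
(* A common tail of [x] and [x'] on the cycle, where turns can be inserted. *)
pose u := iter (i + s) sX x.
have us : u = iter (j + s) sX x' by rewrite /u !(addnC _ s) !iterD e.
have xu : iter (i + s + lp x) sX x = u.
  by rewrite /u -addnA iterD xs -iterD.
have lagu : (lag k l (lp x) u = (lp (arng f))%:Z)%R.
  by rewrite /u lag_lp_tail// h'K.
have up : iter (lp x) sX u = u by rewrite /u -iterD addnC.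
have lags : (lag k l (i + s) x - lag k l (j + s) x' = A0%:Z - B0%:Z)%R.
  by rewrite -d0; apply: lag_indep => //; lia.
have lag_up t : (lag k l (t * lp x) u = t%:Z * (lp (arng f))%:Z)%R.
  by rewrite lag_mul// lagu.
have upt t : iter (t * lp x) sX u = u by exact: iter_periodic.
(* The sign of the error decides whether the turns go to the range or to the source exponent. *)
have [le|/ltnW le] := leqP (B + A0) (B0 + A).
  have /dvdnP[t tE] := lp_dvd le loop.
  exists (i + s + t * lp x), (j + s); split.
    by rewrite addnC iterD -/u upt us.
  by rewrite (lagD _ _ (i + s)) -/u lag_up; lia.
have /dvdnP[t tE] := lp_dvd le (esym loop).
exists (i + s), (j + s + t * lp x); split.
  by rewrite [_ + t * _]addnC [RHS]iterD -us upt.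
by rewrite (lagD _ _ (j + s)) -us lag_up; lia.
Qed.

End NormalizedMap.

(** * Assembly of the isomorphism *)

Theorem proposition4p5 (a b : finType) (X : sft a) (Y : sft b) (h : X -> Y) :
  continuous_orbit_equivalence h ->
  (forall x : X, eventually_periodic (h x) <-> eventually_periodic x) /\
  exists phi : sft_groupoid X -> sft_groupoid Y,
    [/\ topological_groupoid_iso phi,
        forall eta : sft_groupoid X, grng (phi eta) = h (grng eta),
        forall eta : sft_groupoid X, gsrc (phi eta) = h (gsrc eta) &
        forall (x : X) (ex : eventually_periodic x)
          (ehx : eventually_periodic (h x)),
          phi (lp_arrow ex) = lp_arrow ehx].
Proof.
move=> [h' [[hK h'K hc h'c] [[k [l [kc lc kl]]] [k' [l' [kc' lc' kl']]]]]].
have hkl0 : orbit_lags h k l by split => //; exact: continuous_locally_constant.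
have hkl' : orbit_lags h' k' l'.
  by split => //; exact: continuous_locally_constant.
have hper x : eventually_periodic x -> eventually_periodic (h x).
  exact: orbit_lags_eventually_periodic hkl0 x.
have h'per y : eventually_periodic y -> eventually_periodic (h' y).
  exact: orbit_lags_eventually_periodic hkl' y.
split=> [x|]; first by split=> [/h'per|/hper//]; rewrite hK.
have [k1 [l1 [hkl hlp]]] := normalized_orbit_lags hK h'K hc h'c hkl0 hkl'.
have phi_inj : injective (map_arrow hkl) by exact: (normalized_map_arrow_inj hK).
have /choice[psi psiK] : forall f, exists g, map_arrow hkl g = f.
  exact: (normalized_map_arrow_surj h'K hkl hlp hkl' h'per).
exists (map_arrow hkl); split => //.
- split.
  + exists psi; split => //.
    * by move=> g; apply: phi_inj; rewrite psiK.
    * exact: map_arrow_continuous.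
    * move=> f W fW; rewrite -[f]psiK.
      apply: filterS (map_arrow_open hkl hc hK h'K h'c fW) => _ [g Wg <-].
      have gK : psi (map_arrow hkl g) = g by apply: phi_inj; rewrite psiK.
      by rewrite /preimage /= gK.
  + by move=> f g; split=> [/= ->//|/(can_inj hK)].
  + by move=> f g fg hfg; exact: map_arrow_mul.
move=> x ex ehx; apply: sft_arrow_inj => //=.
have [j xj] := lp_period ex.
(* With exponents [j + lp x] and [j] the lags differ by the lag over one period at [sigma^j x],
   where the normalization applies. *)
rewrite (@arrow_lagE _ _ k1 l1 (lp_arrow ex) (j + lp x) j) //=; last by lia.
by rewrite lagD (lag_lp_tail hkl hlp (lp_gt0 ex) xj); lia.
Qed.
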